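(* Let $\Lambda\subset\mathbb{R}^n$ be a convex compact set and $\Omega\subset\Lambda$ a non-empty open set, and let $K=\Lambda\setminus\Omega$. Let $f:\Lambda\to\mathbb{R}$ be bounded and uniformly continuous, with $|f(x)|\le A_0$ for all $x\in K$, for some $A_0>0$. Let $\tilde f$ be a bounded and uniformly continuous extension of $f$ to $\mathbb{R}^n$ with $\tilde f(x)=c_0$ ($c_0\in\mathbb{R}$ constant) outside an open ball $B(0;r)$, $r>0$, such that $K\subset B(0;r)$. For $R>r$ let $K_R=K\cup B^c(0;R)$ and let $f_{K_R}(x)=f(x)$ for $x\in K$ and $f_{K_R}(x)=c_0$ for $x\in B^c(0;R)$. Let $\omega$ be the least concave majorant of the modulus of continuity of $\tilde f$ and let $a,b\ge0$ be such that $\omega(t)\le at+b$ for $t\ge0$. For $x\in\mathrm{co}[K]$ let $r_c(x)\ge0$ be the convex density radius of $x$ with respect to $K$. (1) For all $\lambda>0$, $M>A_0+\lambda(R+r)^2$ and all $x\in\mathrm{co}[K]$, $$|A^M_\lambda(f_{K_R})(x)-\tilde f(x)|\le\omega\left(r_c(x)+\frac{a}{\lambda}+\sqrt{\frac{2b}{\lambda}}\right).$$ (2) If furthermore $\tilde f$ is globally Lipschitz with Lipschitz constant $L>0$, then for $\lambda>0$, $M>A_0+\lambda(R+r)^2$ and all $x\in\mathrm{co}[K]$, $$|A^M_\lambda(f_{K_R})(x)-f(x)|\le Lr_c(x)+\frac{L^2}{\lambda}.$$ (3) If furthermore $\tilde f$ is a $C^{1,1}$ function with $|D\tilde f(x)-D\tilde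 f(y)|\le L|x-y|$ for all $x,y\in\mathbb{R}^n$, with $L>0$, then for $\lambda>L$, $M>A_0+\lambda(R+r)^2$ and all $x\in\mathrm{co}[K]$, $$|A^M_\lambda(f_{K_R})(x)-\tilde f(x)|\le\frac{L}{4}\left(\frac{\lambda+L/2}{\lambda-L/2}+1\right)r_c^2(x).$$ Furthermore, in this case (3), $A^M_\lambda(f_{K_R})$ is an interpolation of $f_K$ in $\mathbb{R}^n$, i.e. $A^M_\lambda(f_{K_R})(x)=f(x)$ for all $x\in K$.
   Context: $\mathrm{co}[E]$ is the convex hull of a set $E$; $\mathrm{co}[g]$ is the convex envelope of a function $g:\mathbb{R}^n\to\mathbb{R}$ bounded below. $B^c(0;R)=\mathbb{R}^n\setminus B(0;R)$. For bounded $g$ and $\lambda>0$, $$C^l_\lambda(g)(x)=\mathrm{co}[\lambda|\cdot|^2+g](x)-\lambda|x|^2,\qquad C^u_\lambda(g)(x)=\lambda|x|^2-\mathrm{co}[\lambda|\cdot|^2-g](x).$$ For a closed set $H\subset\mathbb{R}^n$ and a bounded function $f_H:H\to\mathbb{R}$, and $M>0$, $f_H^{\pm M}$ is the function on $\mathbb{R}^n$ equal to $f_H$ on $H$ and to $\pm M$ on $\mathbb{R}^n\setminus H$, and $A^M_\lambda(f_H)=\tfrac12\bigl(C^l_\lambda(f_H^M)+C^u_\lambda(f_H^{-M})\bigr)$. Here this is used with $H=K_R$. The modulus of continuity of $\tilde f$ is $\omega_{\tilde f}(t)=\sup\{|\tilde f(x)-\tilde f(y)|:\ x,y\in\mathbb{R}^n,\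 |x-y|\le t\}$, $t\ge0$; its least concave majorant is the smallest concave function on $[0,\infty)$ that is $\ge\omega_{\tilde f}$. The convex density radius of $x\in\mathrm{co}[K]$ with respect to $K$ is $r_c(x)=\inf\{\rho\ge0:\ x\in\mathrm{co}[\bar B(x;\rho)\cap K]\}$. *)

(* Defs.v *)
From HB Require Import structures.
From mathcomp Require Import all_boot all_order all_algebra.
From mathcomp Require Import all_classical all_reals all_analysis.

Set Implicit Arguments.
Unset Strict Implicit.
Unset Printing Implicit Defensive.

Import Order.TTheory GRing.Theory Num.Theory.
Import numFieldNormedType.Exports.

Local Open Scope classical_set_scope.
Local Open Scope ring_scope.

(* The library norm on 'rV[R]_n is the sup norm. It is used only through the
   topology and uniformity that it shares with the Euclidean norm; every metric
   quantity below is Euclidean. *)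
Definition enorm (R : realType) (n : nat) (x : 'rV[R]_n) : R :=
  Num.sqrt (\sum_(i < n) x 0 i ^+ 2).

Definition eball (R : realType) (n : nat) (x : 'rV[R]_n) (r : R) :
    set 'rV[R]_n :=
  [set y | enorm (y - x) < r].

Definition ecball (R : realType) (n : nat) (x : 'rV[R]_n) (r : R) :
    set 'rV[R]_n :=
  [set y | enorm (y - x) <= r].

Definition convex_hull (R : realType) (n : nat) (E : set 'rV[R]_n) :
    set 'rV[R]_n :=
  smallest (@convex_set R 'rV[R]_n) E.

(* The greatest convex function below g: for g bounded below the set is
   nonempty (it contains the value of a constant function) and bounded above by
   g x, so the real-valued sup is the intended one. *)
Definition convex_envelope (R : realType) (n : nat) (g : 'rV[R]_n -> R)
    (x : 'rV[R]_n) : R :=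
  sup [set h x | h in [set h : 'rV[R]_n -> R |
         @convex_function R 'rV[R]_n setT h /\ forall y, h y <= g y]].

Definition lower_transform (R : realType) (n : nat) (lambda : R)
    (g : 'rV[R]_n -> R) (x : 'rV[R]_n) : R :=
  convex_envelope (fun y => lambda * enorm y ^+ 2 + g y) x
  - lambda * enorm x ^+ 2.

Definition upper_transform (R : realType) (n : nat) (lambda : R)
    (g : 'rV[R]_n -> R) (x : 'rV[R]_n) : R :=
  lambda * enorm x ^+ 2
  - convex_envelope (fun y => lambda * enorm y ^+ 2 - g y) x.

(* f : H -> R is represented by a function on the whole space, of which only
   the values on H are used: [patch (fun=> M) H f] is f on H and M elsewhere. *)
Definition average_approx (R : realType) (n : nat) (H : set 'rV[R]_n)
    (lambda M : R) (f : 'rV[R]_n -> R) (x : 'rV[R]_n) : R :=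
  2^-1 * (lower_transform lambda (patch (fun=> M) H f) x
          + upper_transform lambda (patch (fun=> - M) H f) x).

Definition modulus_of_continuity (R : realType) (n : nat)
    (f : 'rV[R]_n -> R) (t : R) : R :=
  sup [set d | exists x y : 'rV[R]_n,
         enorm (x - y) <= t /\ d = `|f x - f y|].

Definition concave_on_nonneg (R : realType) (h : R -> R) : Prop :=
  @convex_function R R^o [set t : R | 0 <= t] (fun t => - h t).

Definition is_least_concave_majorant (R : realType) (w omega : R -> R) : Prop :=
  [/\ concave_on_nonneg omega,
      forall t, 0 <= t -> w t <= omega t
    & forall h, concave_on_nonneg h -> (forall t, 0 <= t -> w t <= h t) ->
        forall t, 0 <= t -> omega t <= h t].

Definition convex_density_radius (R : realType) (n : nat) (K : set 'rV[R]_n)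
    (x : 'rV[R]_n) : R :=
  inf [set rho | 0 <= rho /\ convex_hull (ecball x rho `&` K) x].

Definition euclidean_lipschitz (R : realType) (n : nat) (L : R)
    (f : 'rV[R]_n -> R) : Prop :=
  forall x y, `|f x - f y| <= L * enorm (x - y).

Definition gradient (R : realType) (n : nat) (f : 'rV[R]_n -> R)
    (x : 'rV[R]_n) : 'rV[R]_n :=
  \row_(i < n) ('d f x (delta_mx 0 i) : R).

Definition C11 (R : realType) (n : nat) (L : R) (f : 'rV[R]_n -> R) : Prop :=
  (forall x, differentiable f x) /\
  (forall x y, enorm (gradient f x - gradient f y) <= L * enorm (x - y)).

(* Main.v *)
Require Import Defs.
From HB Require Import structures.
From mathcomp Require Import all_boot all_order all_algebra.
From mathcomp Require Import all_classical all_reals all_analysis.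

From mathcomp Require Import ring lra.

Set Implicit Arguments.
Unset Strict Implicit.
Unset Printing Implicit Defensive.

Import Order.TTheory GRing.Theory Num.Theory.
Import numFieldNormedType.Exports.

Local Open Scope classical_set_scope.
Local Open Scope ring_scope.

(** Write g for the extended function and A for the average approximation.

    The convex envelope of G at x is the infimum of E_d[G] over the finitely
    supported probability distributions d with barycenter x
    ([convex_envelope_le], [le_convex_envelope]).  Since
    E_d|y|^2 = |x|^2 + E_d|y - x|^2, the lower transform of G at x is the
    infimum of lambda E_d|y - x|^2 + E_d[G], and the upper transform is the
    supremum of E_d[G] - lambda E_d|y - x|^2.  Because A is odd in the
    function, it is enough to bound A(x) - g(x) from below.

    As long as c0 <= M, an atom of d in the gap between K and the far region
    costs M, and replacing it by an atom in K and one far away, aligned with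
    it, does not raise the cost ([gap_refine]): this is what the lower bound
    on M is for.  So in the lower transform d may be assumed to be supported
    where the data are those of g, and for such d both d itself and any
    distribution d' on K near x can be tested in the upper transform
    ([le_average_approx]).  With D^2 = E_d|y - x|^2 and
    rho^2 = E_d'|y - x|^2 this gives, for the better of the two choices,

      2 (A(x) - g(x)) >= lambda D^2 + P + max (P - lambda D^2, Q - lambda rho^2)

    where P = E_d[g] - g(x) and Q = E_d'[g] - g(x).  The distribution d' is
    chosen with rho barely above the convex density radius r_c of x.

    When g has a concave modulus omega, Jensen's inequality gives
    P >= - omega(D) and Q >= - omega(rho).  Let
    T = r_c + a / lambda + sqrt (2 b / lambda).  If D <= T, the choice d' = d
    gives - omega(T).  If D > T, the bound omega(t) <= a t + b makes
    lambda (D^2 - rho^2) absorb both moduli, and the other choice gives a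
    nonnegative number ([le_average_modulus]).  The Lipschitz statement is the
    case omega(t) = a t with a = L and b = 0.  When g is C^{1,1}, the linear
    part of g at x has mean zero under d and d', so P >= - L/2 D^2 and
    Q >= - L/2 rho^2; comparing D with r_c in the same way yields the bound
    L/2 r_c^2 ([le_average_C11]), which is at most the one stated, and vanishes
    on K.

    The constant c0 may exceed M, and then gap atoms cannot be replaced.  In
    the C^{1,1} case this does not happen, by a second difference of g at a far
    point.  In the modulus case it forces omega(2 r) > lambda (R + r)^2, hence
    T >= 2 r, so that omega(T) dominates the whole oscillation of g. *)

(** * The Euclidean inner product *)
Section Euclid.
Context {R : realType} {n : nat}.
Implicit Types u v w x y : 'rV[R]_n.

Definition edot u v : R := \sum_(i < n) u 0 i * v 0 i.

Lemma edotC u v : edot u v = edot v u.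
Proof. by apply: eq_bigr => i _; rewrite mulrC. Qed.

Lemma edotDr u v w : edot u (v + w) = edot u v + edot u w.
Proof. by rewrite -big_split; apply: eq_bigr => i _; rewrite mxE mulrDr. Qed.

Lemma edotZr (c : R) u v : edot u (c *: v) = c * edot u v.
Proof. by rewrite mulr_sumr; apply: eq_bigr => i _; rewrite mxE mulrCA. Qed.

Lemma edotNr u v : edot u (- v) = - edot u v.
Proof. by rewrite -scaleN1r edotZr mulN1r. Qed.

Lemma edotDl u v w : edot (u + v) w = edot u w + edot v w.
Proof. by rewrite edotC edotDr !(edotC w). Qed.

Lemma edotZl (c : R) u v : edot (c *: u) v = c * edot u v.
Proof. by rewrite edotC edotZr edotC. Qed.

Lemma edotNl u v : edot (- u) v = - edot u v.
Proof. by rewrite edotC edotNr edotC. Qed.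

Definition edotE := (edotDl, edotDr, edotNl, edotNr, edotZl, edotZr).

Lemma enorm_ge0 u : 0 <= enorm u.
Proof. exact: sqrtr_ge0. Qed.

Lemma sqr_enorm u : enorm u ^+ 2 = edot u u.
Proof.
rewrite sqr_sqrtr; first by apply: eq_bigr => i _; rewrite expr2.
by apply: sumr_ge0 => i _; exact: sqr_ge0.
Qed.

Lemma edot_ge0 u : 0 <= edot u u.
Proof. by rewrite -sqr_enorm sqr_ge0. Qed.

Lemma enorm_eq0 u : enorm u = 0 -> u = 0.
Proof.
move=> u0; have : edot u u = 0 by rewrite -sqr_enorm u0 expr0n.
move=> /eqP; rewrite psumr_eq0 => [|i _]; last by rewrite -expr2 sqr_ge0.
move=> /allP h; apply/rowP => i; rewrite mxE.
by have := h i (mem_index_enum _); rewrite /= mulf_eq0 orbb => /eqP.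
Qed.

Lemma enorm_gt0 u : u != 0 -> 0 < enorm u.
Proof.
by move=> u0; rewrite lt_neqAle enorm_ge0 andbT eq_sym;
  apply: contra u0 => /eqP/enorm_eq0 ->.
Qed.

Lemma enormZ (c : R) u : enorm (c *: u) = `|c| * enorm u.
Proof.
apply/eqP; rewrite -(@eqrXn2 _ 2)// ?mulr_ge0 ?enorm_ge0//.
by rewrite exprMn real_normK ?num_real// !sqr_enorm !edotE mulrA.
Qed.

Lemma enormN u : enorm (- u) = enorm u.
Proof. by rewrite -scaleN1r enormZ normrN1 mul1r. Qed.

(** Expand the square norm of [enorm v *: u - enorm u *: v]. *)
Lemma edot_le u v : edot u v <= enorm u * enorm v.
Proof.
have [/enorm_eq0 ->|v0] := eqVneq (enorm v) 0.
  by rewrite -(scale0r 0) edotZr mul0r mulr_ge0 ?enorm_ge0.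
have v_gt0 : 0 < enorm v by rewrite lt_neqAle eq_sym v0 enorm_ge0.
have := edot_ge0 (enorm v *: u - enorm u *: v).
have uv_ge0 := mulr_ge0 (enorm_ge0 u) (enorm_ge0 v).
rewrite !edotE (edotC v u) -!sqr_enorm => h.
have [/eqP|u0] := boolP (enorm u == 0).
  by move=> /enorm_eq0 ->; rewrite -(scale0r 0) edotZl mul0r mulr_ge0 ?enorm_ge0.
have u_gt0 : 0 < enorm u by rewrite lt_neqAle eq_sym u0 enorm_ge0.
rewrite -(@ler_pM2l _ (enorm u * enorm v)) ?mulr_gt0//; nra.
Qed.

Lemma enormD u v : enorm (u + v) <= enorm u + enorm v.
Proof.
rewrite -(@ler_pXn2r _ 2) ?nnegrE ?addr_ge0 ?enorm_ge0//.
have := edot_le u v.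
rewrite sqrrD !sqr_enorm !edotE (edotC v u); lra.
Qed.

Lemma enorm_subC u v : enorm (u - v) = enorm (v - u).
Proof. by rewrite -enormN opprB. Qed.

End Euclid.

(** * Finitely supported probability distributions *)
Section Mean.
Context {R : realType} {V : lmodType R}.
Implicit Types (t : {i01 R}) (x y : V).

(** A binary tree of mixtures: convexity statements about a distribution
    reduce, by induction on the tree, to their two-point instances, and a
    mixture of distributions is itself a constructor. *)
Inductive fdist : Type :=
| Dirac of V
| Mix of {i01 R} & fdist & fdist.

Implicit Types d : fdist.

Fixpoint mean (W : lmodType R) (phi : V -> W) d : W :=
  match d with
  | Dirac y => phi y
  | Mix t d1 d2 => t%:num *: mean phi d1 + (1 - t%:num) *: mean phi d2
  end.

Definition bary d : V := mean id d.
(** The type ascription selects the structure of left module of [R] over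
    itself, for which scaling is the product. *)
Definition expect (phi : V -> R) d : R := mean (phi : V -> R^o) d.

Fixpoint supported (S : set V) d : Prop :=
  match d with
  | Dirac y => S y
  | Mix _ d1 d2 => supported S d1 /\ supported S d2
  end.

Lemma expect_Mix phi t d1 d2 : expect phi (Mix t d1 d2) =
  t%:num * expect phi d1 + (1 - t%:num) * expect phi d2.
Proof. by []. Qed.

Lemma i01P t : 0 <= t%:num <= (1 : R).
Proof. by apply/andP; split. Qed.

Lemma conv_affineE t (a b : R^o) :
  conv t a b = t%:num * a + (1 - t%:num) * b :> R.
Proof. by []. Qed.

Lemma supportedW S S' d : S `<=` S' -> supported S d -> supported S' d.
Proof. by move=> SS'; elim: d => [y /SS'|t a iha b ihb] //= [/iha ? /ihb ?]. Qed.

Lemma supported_neq0 S d : supported S d -> S !=set0.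
Proof. by elim: d => [y Sy|t d1 ih1 d2 ih2 /= [/ih1]//]; exists y. Qed.

Lemma supportedT d : supported setT d.
Proof. by elim: d => [y|t a iha b ihb]. Qed.

Lemma le_expect S phi psi d : supported S d ->
  (forall y, S y -> phi y <= psi y) -> expect phi d <= expect psi d.
Proof.
move=> dS le; elim: d dS => [y /le//|t a iha b ihb] /= [/iha ha /ihb hb].
rewrite !expect_Mix; have := i01P t; nra.
Qed.

Lemma eq_expect phi psi d : phi =1 psi -> expect phi d = expect psi d.
Proof. by move=> /funext ->. Qed.

Lemma expect_cst c d : expect (fun=> c) d = c.
Proof. by elim: d => [//|t a iha b ihb]; rewrite expect_Mix iha ihb; ring. Qed.

Lemma expectD phi psi d :
  expect (fun y => phi y + psi y) d = expect phi d + expect psi d.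
Proof. by elim: d => [//|t a iha b ihb]; rewrite !expect_Mix iha ihb; ring. Qed.

Lemma expectZ c phi d : expect (fun y => c * phi y) d = c * expect phi d.
Proof. by elim: d => [//|t a iha b ihb]; rewrite !expect_Mix iha ihb; ring. Qed.

Lemma expectN phi d : expect (fun y => - phi y) d = - expect phi d.
Proof. by elim: d => [//|t a iha b ihb]; rewrite !expect_Mix iha ihb; ring. Qed.

Lemma expectB phi psi d :
  expect (fun y => phi y - psi y) d = expect phi d - expect psi d.
Proof. by rewrite expectD expectN. Qed.

(** Nonnegativity of the variance. *)
Lemma sqr_expect_le phi d : expect phi d ^+ 2 <= expect (fun y => phi y ^+ 2) d.
Proof.
set m := expect phi d.
have : 0 <= expect (fun y => phi y ^+ 2 + (- (2 * m) * phi y + m ^+ 2)) d.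
  rewrite -[leLHS](expect_cst 0 d); apply: (le_expect (supportedT d)) => y _.
  by have := sqr_ge0 (phi y - m); nra.
by rewrite expectD expectD expectZ expect_cst -/m; nra.
Qed.

Lemma jensen_convex (h : V -> R) d :
  @convex_function R V setT h -> h (bary d) <= expect h d.
Proof.
move=> hc; elim: d => [y|t a iha b ihb]; first exact: lexx.
rewrite expect_Mix /bary/=.
have := hc t (bary a) (bary b); rewrite !in_setT => /(_ erefl erefl).
move=> /le_trans; apply; rewrite conv_affineE.
by have := i01P t; nra.
Qed.

Lemma expect_ge0 phi d : (forall y, 0 <= phi y) -> 0 <= expect phi d.
Proof.
by move=> h; rewrite -[leLHS](expect_cst 0 d); apply: (le_expect (supportedT d)).
Qed.

Lemma jensen_concave (omega : R -> R) phi d : concave_on_nonneg omega ->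
  (forall y, 0 <= phi y) ->
  expect (fun y => omega (phi y)) d <= omega (expect phi d).
Proof.
move=> hc phi0; elim: d => [y|t a iha b ihb]; first exact: lexx.
have := hc t (expect phi a) (expect phi b).
rewrite !inE/= !expect_ge0// => /(_ erefl erefl).
rewrite conv_affineE expect_Mix => h.
have -> : expect phi (Mix t a b) =
  conv t (expect phi a : convex_lmodType R^o) (expect phi b) by [].
by have := i01P t; nra.
Qed.

(** Barycenters of distributions on [E] form a convex set containing [E]. *)
Lemma convex_hull_bary (E : set V) x :
  smallest (@convex_set R V) E x -> exists2 d, supported E d & bary d = x.
Proof.
pose C : set V := [set x | exists2 d, supported E d & bary d = x].
apply: (@smallest_sub _ _ _ C); last by move=> y Ey; exists (Dirac y).
move=> y z t; rewrite !inE => -[d1 d1E <-] [d2 d2E <-].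
by exists (Mix t d1 d2).
Qed.

(** Substituting at each atom a distribution that has this atom as barycenter
    keeps the overall barycenter; this is how unwanted atoms are removed. *)
Lemma supported_refine (S : set V) (G : V -> R) :
  (forall y, exists d, [/\ supported S d, bary d = y & expect G d <= G y]) ->
  forall d, exists d',
    [/\ supported S d', bary d' = bary d & expect G d' <= expect G d].
Proof.
move=> ref; elim=> [y|t a [a' [aS ab aG]] b [b' [bS bb bG]]]; first exact: ref.
exists (Mix t a' b'); split => //.
  by rewrite /bary/= -/(bary a') -/(bary b') ab bb.
by rewrite !expect_Mix; have := i01P t; nra.
Qed.

End Mean.
Arguments fdist {R} V.

(** * Envelopes and transforms as extrema over distributions *)
Section Envelope.
Context {R : realType} {n : nat}.
Local Notation V := 'rV[R]_n.
Implicit Types (x y : V) (d : fdist V) (G h : V -> R).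

Lemma convex_envelope_le G m d : (forall y, m <= G y) ->
  convex_envelope G (bary d) <= expect G d.
Proof.
move=> mG; apply: ge_sup => [|_ [h [hc hG] <-]].
  exists m, (fun=> m) => //; split => // t x y _ _.
  by rewrite conv_affineE; lra.
apply: le_trans (jensen_convex d hc) _.
by apply: (le_expect (supportedT d)) => y _.
Qed.

(** The function sending y to the infimum of the means of [G] over the
    distributions with barycenter y is convex and below [G], hence below the
    envelope. *)
Lemma le_convex_envelope G m x B : (forall y, m <= G y) ->
  (forall d, bary d = x -> B <= expect G d) -> B <= convex_envelope G x.
Proof.
move=> mG BG.
pose S y := [set v | exists2 d, bary d = y & v = expect G d].
pose h y := inf (S y).
have S0 y : S y !=set0 by exists (G y), (Dirac y).
have Sm y : lbound (S y) m.
  move=> _ [d _ ->]; rewrite -[leLHS](expect_cst m d).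
  exact: (le_expect (supportedT d)).
have infS y : has_inf (S y) by split => //; exists m.
have h_le d : h (bary d) <= expect G d.
  by apply: ge_inf; [exists m | exists d].
have hx : B <= h x by apply: lb_le_inf => // _ [d dx ->]; exact: BG.
apply: le_trans hx _; apply: ub_le_sup.
  by exists (G x) => _ [k [_ kG] <-].
exists h => //; split; last by move=> y; exact: (h_le (Dirac y)).
move=> t y z _ _; rewrite conv_affineE; apply/ler_addgt0Pr => e e0.
have [_ [d1 d1y ->] h1] := inf_adherent e0 (infS y).
have [_ [d2 d2z ->] h2] := inf_adherent e0 (infS z).
have := h_le (Mix t d1 d2); rewrite expect_Mix /bary/= -/(bary d1) -/(bary d2).
rewrite d1y d2z => /le_trans; apply.
rewrite -/(h y) -/(h z) in h1 h2; have := i01P t; nra.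
Qed.

Definition spread x d : R := expect (fun y => enorm (y - x) ^+ 2) d.

(** In particular the mean vanishes when [x] is the barycenter, which is what
    cancels first-order terms below. *)
Lemma expect_edot p x d :
  expect (fun y => edot p (y - x)) d = edot p (bary d - x).
Proof.
elim: d => [//|t a iha b ihb]; rewrite expect_Mix iha ihb.
by rewrite /bary/= !edotE; ring.
Qed.

(** This identity turns the quadratic weight at the origin, used in the
    transforms, into a penalty on the spread around the barycenter. *)
Lemma expect_sqr_enorm d :
  expect (fun y => enorm y ^+ 2) d = spread (bary d) d + enorm (bary d) ^+ 2.
Proof.
rewrite /spread; set x := bary d.
have -> : expect (fun y => enorm y ^+ 2) d =
  expect (fun y => (enorm (y - x) ^+ 2 + (edot (2 *: x) (y - x) + enorm x ^+ 2))) d.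
  by apply: eq_expect => y; rewrite !sqr_enorm !edotE (edotC y x); ring.
rewrite !expectD expect_cst expect_edot subrr.
by rewrite -(scale0r 0) edotZr mul0r add0r.
Qed.

Lemma spread_ge0 x d : 0 <= spread x d.
Proof. by apply: expect_ge0 => y; exact: sqr_ge0. Qed.

Lemma lower_transform_le lambda g m d : 0 <= lambda -> (forall y, m <= g y) ->
  lower_transform lambda g (bary d) <= lambda * spread (bary d) d + expect g d.
Proof.
move=> l0 mg; rewrite lerBlDr.
have G_ge y : m <= lambda * enorm y ^+ 2 + g y.
  by rewrite -[m]add0r lerD// mulr_ge0// sqr_ge0.
apply: le_trans (convex_envelope_le d G_ge) _.
by rewrite expectD expectZ expect_sqr_enorm; lra.
Qed.

Lemma le_lower_transform lambda g m x B : 0 <= lambda -> (forall y, m <= g y) ->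
  (forall d, bary d = x -> B <= lambda * spread x d + expect g d) ->
  B <= lower_transform lambda g x.
Proof.
move=> l0 mg Bg; rewrite lerBrDr.
apply: (@le_convex_envelope _ m) => [y|d dx].
  by rewrite -[m]add0r lerD// mulr_ge0// sqr_ge0.
have := Bg d dx.
by rewrite expectD expectZ expect_sqr_enorm dx; lra.
Qed.

Lemma lower_transformN lambda (g : V -> R) x :
  lower_transform lambda (fun y => - g y) x = - upper_transform lambda g x.
Proof. by rewrite /lower_transform /upper_transform opprB. Qed.

Lemma le_upper_transform lambda (g : V -> R) m d : 0 <= lambda ->
  (forall y, g y <= m) ->
  expect g d - lambda * spread (bary d) d <= upper_transform lambda g (bary d).
Proof.
move=> l0 gm; rewrite -lerN2 -lower_transformN.
have Ng y : - m <= - g y by rewrite lerN2.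
by apply: le_trans (lower_transform_le d l0 Ng) _; rewrite expectN; lra.
Qed.

Lemma eq_average_approx (H : set V) lambda M (f g : V -> R) :
  (forall y, H y -> f y = g y) ->
  average_approx H lambda M f = average_approx H lambda M g.
Proof.
move=> fg; have pE m : patch (fun=> m) H f = patch (fun=> m) H g.
  by apply/funext => y; rewrite /patch; case: ifP => // /set_mem/fg.
by apply/funext => x; rewrite /average_approx !pE.
Qed.

Lemma average_approxN (H : set V) lambda M (f : V -> R) x :
  average_approx H lambda M (fun y => - f y) x = - average_approx H lambda M f x.
Proof.
rewrite /average_approx.
have pE m : patch (fun=> - m) H (fun y => - f y) = fun y => - patch (fun=> m) H f y.
  by apply/funext => y; rewrite /patch; case: ifP.
rewrite -{1}[M]opprK !pE lower_transformN.
have : forall g, upper_transform lambda (fun y => - g y) x = - lower_transform lambda g x.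
  move=> g; rewrite -[LHS]opprK -lower_transformN; congr (- lower_transform _ _ _).
  by apply/funext => y; rewrite opprK.
by move=> ->; ring.
Qed.

End Envelope.

(** * Moduli of continuity *)
Section Concave.
Context {R : realType}.
Implicit Type omega : R -> R.

(** A concave function that decreases somewhere keeps decreasing at least
    linearly, so it cannot stay nonnegative. *)
Lemma concave_ge0_homo omega : concave_on_nonneg omega ->
  (forall t, 0 <= t -> 0 <= omega t) ->
  forall s t, 0 <= s -> s <= t -> omega s <= omega t.
Proof.
move=> hc h0 s t s0; rewrite le_eqVlt => /predU1P[->//|st].
rewrite leNgt; apply/negP => ts.
pose k := omega s - omega t; have k0 : 0 < k by rewrite subr_gt0.
(* far enough for the chord from s through t to be negative *)
pose u := t + (t - s) * (omega t + 1) / k.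
have wt0 := h0 t (ltW (le_lt_trans s0 st)).
have ut : t < u.
  by rewrite ltrDl divr_gt0// mulr_gt0// ?subr_gt0// ltr_wpDl.
have us : 0 < u - s by lra.
have p01 : 0 <= (u - t) / (u - s) <= 1.
  by rewrite divr_ge0 ?subr_ge0 ?(ltW ut) ?ler_pdivrMr ?mul1r//=; lra.
pose p : {i01 R} := Itv01 (proj1 (andP p01)) (proj2 (andP p01)).
have := hc p s u; rewrite !inE/= => /(_ s0 (ltW (le_lt_trans s0 (lt_trans st ut)))).
rewrite conv_affineE/= => h.
have E : conv p (s : convex_lmodType R^o) u = t.
  by change (((u - t) / (u - s)) * s + (1 - (u - t) / (u - s)) * u = t); field; lra.
rewrite E in h.
have wu0 : 0 <= omega u by apply: h0; lra.
have : omega s * (u - t) + omega u * (t - s) <= omega t * (u - s).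
  rewrite -ler_pdivrMr//.
  have -> : (omega s * (u - t) + omega u * (t - s)) / (u - s) =
    - ((u - t) / (u - s) * - omega s + (1 - (u - t) / (u - s)) * - omega u).
    by field; lra.
  by rewrite lerNl.
have : k * (u - t) = (t - s) * (omega t + 1).
  by rewrite /u addrAC subrr add0r mulrC mulfVK ?gt_eqF.
rewrite /k; have : 0 < t - s by lra.
nra.
Qed.

Lemma le_modulus n (g : 'rV[R]_n -> R) m x y : (forall z, `|g z| <= m) ->
  `|g x - g y| <= modulus_of_continuity g (enorm (x - y)).
Proof.
move=> gm; apply: ub_le_sup; last by exists x, y.
exists (m + m) => _ [u [v [_ ->]]].
by apply: le_trans (ler_normB _ _) _; rewrite lerD.
Qed.

End Concave.

(** * Lower bounds for the average approximation *)
Section LowerBounds.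
Context {R : realType} {n : nat}.
Local Notation V := 'rV[R]_n.
Implicit Types (x y z e : V) (d : fdist V).

(** The first hypothesis allows the competitors [d] of the lower transform to
    be taken on [H], where the two patched functions agree with [g]; the second
    then pairs each such [d] with one competitor [d'] of the upper transform. *)
Lemma le_average_approx (H : set V) lambda M (g : V -> R) m x B :
  0 <= lambda -> (forall y, `|g y| <= m) ->
  (forall y, exists d, [/\ supported H d, bary d = y &
     expect (fun y => lambda * enorm (y - x) ^+ 2 + patch (fun=> M) H g y) d <=
     lambda * enorm (y - x) ^+ 2 + patch (fun=> M) H g y]) ->
  (forall d, supported H d -> bary d = x ->
     exists d', [/\ supported H d', bary d' = x &
       2 * B <= (lambda * spread x d + expect g d) +
                (expect g d' - lambda * spread x d')]) ->
  B <= average_approx H lambda M g x.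
Proof.
move=> l0 gm ref test.
have g_ge y : - m <= g y by have := gm y; rewrite ler_norml => /andP[].
have g_le y : g y <= m by have := gm y; rewrite ler_norml => /andP[].
have m_ge0 : 0 <= m by apply: le_trans (gm 0).
have M1 := ler_norm M; have M2 := ler_norm (- M); rewrite normrN in M2.
have lo y : - (m + `|M|) <= patch (fun=> M) H g y.
  by rewrite /patch; case: ifP => _; have := g_ge y; lra.
have hi y : patch (fun=> - M) H g y <= m + `|M|.
  by rewrite /patch; case: ifP => _; have := g_le y; lra.
have pE M' d : supported H d -> expect (patch (fun=> M') H g) d = expect g d.
  move=> dH; have pE y : H y -> patch (fun=> M') H g y = g y.
    by move=> Hy; rewrite /patch mem_set.
  by apply/eqP; rewrite eq_le; apply/andP; split;
    apply: (le_expect dH) => y /pE ->.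
rewrite /average_approx ler_pdivlMl// -lerBlDr.
apply: (le_lower_transform l0 lo) => d dx.
have [d1 [d1H d1d d1le]] := supported_refine ref d.
have [d' [d'H d'x Bd']] := test d1 d1H (etrans d1d dx).
have := le_upper_transform d' l0 hi; rewrite d'x (pE _ _ d'H) => U.
move: d1le; rewrite !expectD !expectZ -!/(spread _ _) (pE _ _ d1H) => L; lra.
Qed.

Lemma enorm_ray_ge z e s : 0 <= s -> enorm e = 1 ->
  s - enorm z <= enorm (z + s *: e).
Proof.
move=> s0 e1; rewrite lerBlDr.
have : enorm (z + s *: e - z) <= enorm (z + s *: e) + enorm (- z) by exact: enormD.
by rewrite addrAC subrr add0r enormZ e1 mulr1 ger0_norm// enormN.
Qed.

Lemma density_radius_ge0 (K : set V) x : 0 <= convex_density_radius K x.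
Proof.
rewrite /convex_density_radius; set S := (X in inf X).
have [h|/inf_out ->//] := pselect (has_inf S).
by apply: lb_le_inf; [exact: (proj1 h)|move=> rho []].
Qed.

Lemma density_radius_mem (K : set V) x : K x -> convex_density_radius K x = 0.
Proof.
move=> Kx; apply/eqP; rewrite eq_le density_radius_ge0 andbT.
apply: ge_inf; first by exists 0 => rho [].
split => //; apply: sub_gen_smallest; split => //.
by rewrite /ecball/= subrr -(scale0r 0) enormZ normr0 mul0r.
Qed.

Lemma enorm_bary_le (S : set V) r d : (forall y, S y -> enorm y <= r) ->
  supported S d -> enorm (bary d) <= r.
Proof.
move=> Sr; elim: d => [y /Sr//|t d1 ih1 d2 ih2 /= [/ih1 h1 /ih2 h2]].
rewrite /bary/= -/(bary d1) -/(bary d2).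
apply: le_trans (enormD _ _) _.
have [t0 t1] := andP (i01P t).
rewrite !enormZ !ger0_norm ?subr_ge0//; nra.
Qed.

(** Any distribution witnessing a radius has spread at most its square, since
    all its atoms are in the ball. Strict inequality with [q] avoids the question
    of whether the infimum is attained. *)
Lemma density_radius_lt (K : set V) r x q : (forall y, K y -> enorm y <= r) ->
  convex_hull K x -> convex_density_radius K x < q ->
  exists rho d, [/\ 0 <= rho, rho < q, supported K d, bary d = x
     & spread x d <= rho ^+ 2].
Proof.
move=> Kr xK; have [d0 d0K d0x] := convex_hull_bary xK.
case/inf_lt.
  exists (`|r| + enorm x); split; first by rewrite addr_ge0// enorm_ge0.
  suff -> : ecball x (`|r| + enorm x) `&` K = K by [].
  apply/seteqP; split => [y []//|y Ky]; split => //.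
  rewrite /ecball/=; apply: le_trans (enormD _ _) _; rewrite enormN lerD2r.
  exact: le_trans (Kr _ Ky) (ler_norm _).
move=> rho [rho0 /convex_hull_bary [d dS dx]] rhoq.
exists rho, d; split => //; first by apply: supportedW dS => y [].
rewrite /spread -[leRHS](expect_cst (rho ^+ 2) d).
apply: (le_expect dS) => y [yrho _].
by rewrite ler_pXn2r// nnegrE enorm_ge0.
Qed.

(** Besides the data of the problem, a unit vector [e] gives a direction to
    infinity and [z0] is a point of [K]. Everything assumed here is invariant
    under [(g, c0) |-> (- g, - c0)]. *)
Section Onesided.
Variables (K : set V) (g : V -> R) (m A0 c0 r Rout : R) (e z0 : V).
Hypotheses (r_gt0 : 0 < r) (r_lt : r < Rout) (e1 : enorm e = 1).
Hypotheses (K_sub : forall y, K y -> enorm y < r) (Kz0 : K z0).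
Hypotheses (gK : forall y, K y -> `|g y| <= A0) (gm : forall y, `|g y| <= m).
Hypothesis g_out : forall y, r <= enorm y -> g y = c0.
Let KR := K `|` ~` eball 0 Rout.

Variables (lambda M : R).
Hypotheses (lambda_gt0 : 0 < lambda) (M_gt : A0 + lambda * (Rout + r) ^+ 2 < M).

Lemma KR_out y : Rout <= enorm y -> KR y.
Proof. by move=> y1; right; rewrite /eball/= subr0; apply/negP; rewrite -leNgt. Qed.

(** The far atom [w] is on the ray from [z0] through [y], at distance
    [Rout + r] from [z0]: it lies outside the ball since [z0] has norm less than
    [r], and beyond [y] since [y] has norm less than [Rout].  Replacing [y] by
    the mixture of [w] and [z0] raises the quadratic term by
    t (1 - t) lambda (Rout + r)^2, which the lower bound on [M] pays for. *)
Lemma gap_refine x y : c0 <= M -> exists d, [/\ supported KR d, bary d = y &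
     expect (fun y => lambda * enorm (y - x) ^+ 2 + patch (fun=> M) KR g y) d <=
     lambda * enorm (y - x) ^+ 2 + patch (fun=> M) KR g y].
Proof.
move=> c0M; have [yKR|yKR] := pselect (KR y); first by exists (Dirac y).
have yK : ~ K y by move=> Ky; apply: yKR; left.
have yR : enorm y < Rout by rewrite ltNge; apply/negP => /KR_out.
pose v := y - z0; have v0 : 0 < enorm v.
  by apply: enorm_gt0; rewrite subr_eq0; apply/eqP => yz; apply: yK; rewrite yz.
have z0r := K_sub Kz0.
have vlt : enorm v < Rout + r.
  by apply: le_lt_trans (enormD _ _) _; rewrite enormN ltrD.
have S0 : 0 < Rout + r by lra.
pose t := enorm v / (Rout + r).
have t01 : 0 <= t <= 1.
  by rewrite divr_ge0 ?(ltW v0) ?(ltW S0)//= ler_pdivrMr// mul1r ltW.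
pose w := z0 + (Rout + r) *: ((enorm v)^-1 *: v).
have u1 : enorm ((enorm v)^-1 *: v) = 1.
  by rewrite enormZ gtr0_norm ?invr_gt0// mulVf ?gt_eqF.
have wR : Rout <= enorm w.
  by apply: le_trans (enorm_ray_ge _ (ltW S0) u1); lra.
have tw : t *: w + (1 - t) *: z0 = y.
  rewrite /w scalerDr !scalerA.
  have -> : t * (Rout + r) / enorm v = 1 by rewrite /t; field; rewrite !gt_eqF.
  by apply/rowP => i; rewrite /v !mxE; ring.
pose p : {i01 R} := Itv01 (proj1 (andP t01)) (proj2 (andP t01)).
exists (Mix p (Dirac w) (Dirac z0)); split => //.
  by split; [exact: KR_out | left].
rewrite expect_Mix/= /expect/=.
have wKR : w \in KR by apply/mem_set; exact: KR_out.
have zKR : z0 \in KR by apply/mem_set; left.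
rewrite /patch wKR zKR (memNset yKR).
rewrite (g_out (ltW (lt_le_trans r_lt wR))).
have gz0 : g z0 <= A0 by apply: le_trans (ler_norm _) (gK Kz0).
have -> : enorm (y - x) ^+ 2 = t * enorm (w - x) ^+ 2 +
    (1 - t) * enorm (z0 - x) ^+ 2 - t * (1 - t) * (Rout + r) ^+ 2.
  have <- : enorm (w - z0) = Rout + r.
    by rewrite /w addrAC subrr add0r enormZ u1 mulr1 gtr0_norm.
  clearbody w; rewrite -tw !sqr_enorm !edotE.
  by rewrite (edotC x w) (edotC x z0) (edotC z0 w); ring.
have [t0 t1] := andP t01; clearbody t.
have h1 : 0 <= t * (M - c0) by apply: mulr_ge0; lra.
have h2 : 0 <= (1 - t) * (M - A0 - lambda * (Rout + r) ^+ 2).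
  by rewrite mulr_ge0 ?subr_ge0// lerBrDr addrC ltW.
have h3 : 0 <= (1 - t) * (A0 - g z0) by rewrite mulr_ge0 ?subr_ge0.
have h4 : 0 <= lambda * (Rout + r) ^+ 2 * ((1 - t) * (1 - t)).
  by apply: mulr_ge0; [rewrite mulr_ge0 ?sqr_ge0 ?ltW|rewrite -expr2 sqr_ge0].
lra.
Qed.

(** Test the upper transform with the two points [x] +- [(Rout + r) *: e], both
    far away. *)
Lemma far_le_upper x : enorm x <= r ->
  c0 - lambda * (Rout + r) ^+ 2 <= upper_transform lambda (patch (fun=> - M) KR g) x.
Proof.
have [r0 rR] := (r_gt0, r_lt); move=> xr; have S0 : 0 <= Rout + r by lra.
have half01 : 0 <= 2^-1 :> R by rewrite invr_ge0.
have half1 : 2^-1 <= 1 :> R by rewrite invf_le1 ?ler1n.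
pose p : {i01 R} := Itv01 half01 half1.
have far s : `|s| = Rout + r -> Rout <= enorm (x + s *: e).
  move=> sE; have : enorm (x + s *: e - x) <= enorm (x + s *: e) + enorm x.
    by rewrite -(enormN x); exact: enormD.
  by rewrite addrAC subrr add0r enormZ e1 sE mulr1; lra.
have f1 : Rout <= enorm (x + (Rout + r) *: e) by apply: far; rewrite ger0_norm.
have f2 : Rout <= enorm (x + (- (Rout + r)) *: e).
  by apply: far; rewrite normrN ger0_norm.
pose d := Mix p (Dirac (x + (Rout + r) *: e)) (Dirac (x + (- (Rout + r)) *: e)).
have dx : bary d = x.
  by apply/rowP => i; rewrite /bary/= !mxE; field.
have hi y : patch (fun=> - M) KR g y <= m + `|M|.
  have m_ge0 : 0 <= m by apply: le_trans (gm 0).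
  have := ler_norm (- M); rewrite normrN; have := normr_ge0 M.
  have := le_trans (ler_norm _) (gm y).
  by rewrite /patch; case: ifP => _; lra.
have := le_upper_transform d (ltW lambda_gt0) hi; rewrite dx; apply: le_trans.
rewrite /spread !expect_Mix /expect/= /patch !mem_set; try exact: KR_out.
rewrite !g_out; try lra.
have shift s : x + s *: e - x = s *: e by rewrite addrAC subrr add0r.
rewrite !shift !enormZ e1 normrN ger0_norm// mulr1; lra.
Qed.

Section Modulus.
Variables (omega : R -> R) (a b : R).
Hypotheses (omega_conc : concave_on_nonneg omega)
  (omega_maj : forall x y, `|g x - g y| <= omega (enorm (x - y)))
  (a_ge0 : 0 <= a) (b_ge0 : 0 <= b)
  (omega_le : forall t, 0 <= t -> omega t <= a * t + b).

Lemma omega_ge0 t : 0 <= t -> 0 <= omega t.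
Proof.
move=> t0; apply: le_trans (normr_ge0 _) (le_trans (omega_maj (t *: e) 0) _).
by rewrite subr0 enormZ e1 mulr1 ger0_norm.
Qed.

Lemma omega_homo s t : 0 <= s -> s <= t -> omega s <= omega t.
Proof. exact: concave_ge0_homo omega_ge0 _ _. Qed.

(** Jensen's inequality for the concave [omega], then for the square. *)
Lemma expect_ge_modulus x d :
  g x - omega (Num.sqrt (spread x d)) <= expect g d.
Proof.
have D0 y : 0 <= enorm (y - x) by exact: enorm_ge0.
have E0 : 0 <= expect (fun y => enorm (y - x)) d by exact: expect_ge0.
have ED : expect (fun y => enorm (y - x)) d <= Num.sqrt (spread x d).
  rewrite -(@ler_pXn2r _ 2) ?nnegrE ?sqrtr_ge0// sqr_sqrtr ?spread_ge0//.
  exact: sqr_expect_le.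
have /le_trans /(_ (omega_homo E0 ED)) : expect (fun y => g x - g y) d <=
    omega (expect (fun y => enorm (y - x)) d).
  apply: le_trans (jensen_concave d omega_conc D0).
  apply: (le_expect (supportedT d)) => y _.
  by rewrite enorm_subC; exact: le_trans (ler_norm _) (omega_maj x y).
by rewrite expectB expect_cst; lra.
Qed.

(** The ball has diameter [2 * r], and the value taken outside it is attained
    within distance [2 * r] of each of its points. *)
Lemma osc_le x y : `|g x - g y| <= omega (2 * r).
Proof.
have [r0 rR] := (r_gt0, r_lt).
have inner u v : enorm u < r -> `|g u - g v| <= omega (2 * r).
  move=> ur; have [vr|vr] := ltP (enorm v) r.
    apply: le_trans (omega_maj _ _) (omega_homo (enorm_ge0 _) _).
    by apply: le_trans (enormD _ _) _; rewrite enormN; lra.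
  have r2 : 0 <= 2 * r by lra.
  rewrite (g_out vr) -(@g_out (u + (2 * r) *: e)).
    apply: le_trans (omega_maj _ _) (omega_homo (enorm_ge0 _) _).
    by rewrite opprD addNKr enormN enormZ e1 mulr1 ger0_norm.
  by apply: le_trans (enorm_ray_ge _ r2 e1); lra.
have [/inner//|xr] := ltP (enorm x) r.
have [/inner|yr] := ltP (enorm y) r; first by rewrite distrC.
by rewrite !g_out// subrr normr0 omega_ge0//; lra.
Qed.

(** With D the root mean square distance of [d] to [x] and T the argument of
    [omega], testing with [d' = d] suffices for D <= T, while for D > T the
    distribution [d'] on [K] leaves a gain lambda (D^2 - rho^2) that exceeds
    a (D + rho) + 2 b.  If c0 > M, the whole oscillation is below omega(T). *)
Lemma le_average_modulus x : convex_hull K x -> enorm x <= r ->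
  g x - omega (convex_density_radius K x + a / lambda + Num.sqrt (2 * b / lambda))
  <= average_approx KR lambda M g x.
Proof.
move=> xK xr; set rc := convex_density_radius K x; set s := Num.sqrt _.
have [r0 rR] := (r_gt0, r_lt); have [l0 MM] := (lambda_gt0, M_gt).
have rc0 : 0 <= rc := density_radius_ge0 K x.
have s0 : 0 <= s := sqrtr_ge0 _.
have sE : lambda * s ^+ 2 = 2 * b.
  rewrite sqr_sqrtr; first by field; rewrite gt_eqF.
  by rewrite divr_ge0 ?mulr_ge0// ltW.
have [a' a'E] : exists a', a' = a / lambda by exists (a / lambda).
have a'0 : 0 <= a' by rewrite a'E divr_ge0// ltW.
have aE : a = lambda * a' by rewrite a'E; field; rewrite gt_eqF.
rewrite -a'E; set T := rc + a' + s.
have T0 : 0 <= T by rewrite !addr_ge0.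
have wT0 := omega_ge0 T0.
have [c0M|Mc0] := leP c0 M.
  apply: (le_average_approx (ltW l0) gm (fun y => gap_refine x y c0M)) => d dS dx.
  have P := expect_ge_modulus x d.
  have D0 := sqrtr_ge0 (spread x d).
  have DE := sqr_sqrtr (spread_ge0 x d).
  set D := Num.sqrt (spread x d) in P D0 DE.
  have [DT|TD] := leP D T.
    exists d; split => //; have := omega_homo D0 DT; lra.
  have qlt : rc < D - a' - s by rewrite /T in TD; lra.
  (* T < D leaves room for a radius between the density radius and
     D - a / lambda - s *)
  have [rho [d' [rho0 rhoq d'K d'x d'rho]]] :=
    density_radius_lt (fun y Ky => ltW (K_sub Ky)) xK qlt.
  exists d'; split => //.
    by apply: supportedW d'K => y; left.
  have P' := expect_ge_modulus x d'.
  have D'rho : Num.sqrt (spread x d') <= rho.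
    rewrite -(@ler_pXn2r _ 2) ?nnegrE ?sqrtr_ge0//.
    by rewrite sqr_sqrtr ?spread_ge0.
  have W' := omega_homo (sqrtr_ge0 _) D'rho.
  have [W1 W2] := (omega_le D0, omega_le rho0).
  have key : a * (D + rho) + 2 * b <= lambda * (D ^+ 2 - rho ^+ 2).
    rewrite aE -sE -mulrA -mulrDr ler_pM2l//.
    have h1 : 0 <= (D - rho - a' - s) * (D + rho).
      by apply: mulr_ge0; lra.
    have h2 : 0 <= s * (D + rho - s) by apply: mulr_ge0; lra.
    lra.
  have : lambda * spread x d' <= lambda * rho ^+ 2 by rewrite ler_pM2l.
  rewrite -DE; lra.
have gz := gK Kz0; have gz1 := le_trans (ler_norm _) gz.
have S0 : (2 * r) ^+ 2 < (Rout + r) ^+ 2.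
  by rewrite ltr_pXn2r ?nnegrE//; lra.
have lS : lambda * (2 * r) ^+ 2 < lambda * (Rout + r) ^+ 2 by rewrite ltr_pM2l.
(* from here on c0 > M: the oscillation of [g] is large, which makes T large *)
have c0z : c0 - g z0 <= omega (2 * r).
  have Re : r <= enorm (Rout *: e) by rewrite enormZ e1 mulr1 gtr0_norm; lra.
  by rewrite -(g_out Re); apply: le_trans (ler_norm _) (osc_le _ _).
have r2 : 0 <= 2 * r by lra.
have T2r : 2 * r <= T.
  rewrite leNgt; apply/negP => Tr.
  have := omega_le r2; rewrite aE => W.
  have : lambda * (2 * r) ^+ 2 < lambda * (a' * (2 * r) + s ^+ 2 / 2).
    by move: sE W; lra.
  rewrite ltr_pM2l// => h.
  have sr : s <= 2 * r - a' by rewrite /T in Tr; lra.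
  have : s ^+ 2 <= (2 * r - a') ^+ 2 by rewrite ler_pXn2r ?nnegrE//; lra.
  have : 0 <= a' * (2 * r - a') by apply: mulr_ge0 => //; rewrite /T in Tr; lra.
  have : 0 < r * r by apply: mulr_gt0.
  nra.
have WT := omega_homo r2 T2r.
have lowg y : g x - omega T <= g y.
  by have := le_trans (ler_norm _) (osc_le x y); lra.
have m_ge0 : 0 <= m by apply: le_trans (gm 0).
have lowF y : g x - omega T <= patch (fun=> M) KR g y.
  rewrite /patch; case: ifP => // _; apply: le_trans (lowg z0) _.
  have : 0 <= lambda * (Rout + r) ^+ 2 by rewrite mulr_ge0 ?sqr_ge0 ?ltW.
  lra.
(* all the data lie above [g x - omega T], and testing the upper transform far
   away gives more than [A0] *)
have L : g x - omega T <= lower_transform lambda (patch (fun=> M) KR g) x.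
  apply: (le_lower_transform (ltW l0) lowF) => d _.
  rewrite -[leLHS](expect_cst _ d) -[leLHS]add0r lerD//.
    by rewrite mulr_ge0 ?spread_ge0 ?ltW.
  exact: (le_expect (supportedT d)).
have := far_le_upper xr; have := lowg z0; rewrite /average_approx.
move: L; set lo := lower_transform _ _ _; set up := upper_transform _ _ _; lra.
Qed.
End Modulus.

(** The two choices of [d'] balance at D = r_c, which gives the constant
    L / 2. *)
Lemma le_average_C11 L x : 0 < L -> L < lambda ->
  (forall x, exists p, forall y,
     `|g y - g x - edot p (y - x)| <= L / 2 * enorm (y - x) ^+ 2) ->
  convex_hull K x ->
  g x - L / 2 * convex_density_radius K x ^+ 2 <= average_approx KR lambda M g x.
Proof.
move=> L0 Ll quad xK; set rc := convex_density_radius K x.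
have [r0 rR] := (r_gt0, r_lt); have [l0 MM] := (lambda_gt0, M_gt).
have rc0 : 0 <= rc := density_radius_ge0 K x.
have c0M : c0 <= M.
  have S0 : 0 <= Rout + r by lra.
  have S20 : 0 <= 2 * (Rout + r) by lra.
  have zr := K_sub Kz0.
  (* [w] and [w'] are both far, so the second difference of [g] at [w] is
     [g z0 - c0], and the gradient at [w] cancels *)
  pose w := z0 + (Rout + r) *: e; pose w' := z0 + (2 * (Rout + r)) *: e.
  have gw : g w = c0 by apply: g_out; apply: le_trans (enorm_ray_ge _ S0 e1); lra.
  have gw' : g w' = c0 by apply: g_out; apply: le_trans (enorm_ray_ge _ S20 e1); lra.
  have [p pP] := quad w.
  have := pP w'; have := pP z0.
  have -> : w' - w = (Rout + r) *: e.
    by apply/rowP => i; rewrite /w /w' !mxE; ring.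
  have -> : z0 - w = - ((Rout + r) *: e).
    by apply/rowP => i; rewrite /w !mxE; ring.
  rewrite enormN enormZ e1 mulr1 (ger0_norm S0) gw gw' !edotE.
  rewrite !ler_norml => /andP[h1 h2] /andP[h3 h4].
  have := le_trans (ler_norm _) (gK Kz0).
  have : L * (Rout + r) ^+ 2 <= lambda * (Rout + r) ^+ 2.
    by rewrite ler_wpM2r ?sqr_ge0// ltW.
  lra.
have [p pP] := quad x.
have quadE d : bary d = x -> g x - L / 2 * spread x d <= expect g d.
  move=> dx.
  have : expect (fun y => g x + edot p (y - x) - L / 2 * enorm (y - x) ^+ 2) d
      <= expect g d.
    apply: (le_expect (supportedT d)) => y _.
    by have := pP y; rewrite ler_norml => /andP[h _]; lra.
  rewrite expectB expectD expect_cst expect_edot dx subrr.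
  by rewrite -(scale0r 0) edotZr mul0r expectZ addr0.
apply: (le_average_approx (ltW l0) gm (fun y => gap_refine x y c0M)) => d dS dx.
have P := quadE d dx; set D2 := spread x d in P *.
have [Dr|rD] := leP D2 (rc ^+ 2).
  exists d; split => //.
  have : L / 2 * D2 <= L / 2 * rc ^+ 2 by rewrite ler_wpM2l//; lra.
  by rewrite -/D2; lra.
have lp : 0 < lambda + L / 2 by lra.
have lm : 0 < lambda - L / 2 by lra.
(* the largest value of rho ^+ 2 for which [d'] gives the desired bound *)
pose q2 := rc ^+ 2 + (lambda - L / 2) / (lambda + L / 2) * (D2 - rc ^+ 2).
have q2rc : rc ^+ 2 < q2 by rewrite ltrDl; apply: mulr_gt0; [exact: divr_gt0|rewrite subr_gt0].
have q20 : 0 <= q2 by apply: le_trans (sqr_ge0 rc) (ltW q2rc).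
have rcq : rc < Num.sqrt q2.
  by rewrite -(@ltr_pXn2r _ 2) ?nnegrE ?sqrtr_ge0// sqr_sqrtr.
have [rho [d' [rho0 rhoq d'K d'x d'rho]]] :=
  density_radius_lt (fun y Ky => ltW (K_sub Ky)) xK rcq.
exists d'; split => //; first by apply: supportedW d'K => y; left.
have P' := quadE d' d'x.
have rho2 : rho ^+ 2 < q2.
  by rewrite -(sqr_sqrtr q20) ltr_pXn2r ?nnegrE ?sqrtr_ge0.
have : (lambda + L / 2) * spread x d' <= (lambda + L / 2) * q2.
  by rewrite ler_pM2l//; lra.
have -> : (lambda + L / 2) * q2 =
    (lambda + L / 2) * rc ^+ 2 + (lambda - L / 2) * (D2 - rc ^+ 2).
  by rewrite /q2; field; lra.
rewrite -/D2; lra.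
Qed.

End Onesided.
End LowerBounds.

(** * Second-order bounds for functions with Lipschitz gradient *)
Section Smooth.
Context {R : realType} {n : nat}.
Local Notation V := 'rV[R]_n.
Implicit Types (x y v : V) (g : V -> R).

Lemma diff_gradient g x v : differentiable g x -> 'd g x v = edot (gradient g x) v.
Proof.
move=> gx; rewrite [in LHS](row_sum_delta v) linear_sum; apply: eq_bigr => i _.
by rewrite linearZ mxE mulrC.
Qed.

(** The difference quotient of the restriction to a line is the one defining
    the directional derivative. *)
Lemma is_derive_line g x v (t : R) : differentiable g (x + t *: v) ->
  is_derive t 1 (fun s : R => g (x + s *: v) : R^o) (edot (gradient g (x + t *: v)) v).
Proof.
move=> gt; rewrite -diff_gradient//.
have /(_ v) D := @diff_derivable _ _ _ _ _ _ gt.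
have E : (fun h : R => h^-1 *:
      (((fun s : R => g (x + s *: v) : R^o) \o shift t) (h *: (1 : R^o))
       - g (x + t *: v))) =
  (fun h : R => h^-1 *: ((g \o shift (x + t *: v)) (h *: v) - g (x + t *: v))).
  apply/funext => h /=; congr (_ *: (g _ - _)).
  by rewrite [h *: _]mulr1 scalerDl addrCA.
apply: DeriveDef; first by rewrite /derivable E.
by rewrite /derive E -deriveE.
Qed.

(** After subtracting its linear part at [x] and the quadratic bound, the
    restriction of [g] to the segment has a nonpositive derivative, by the
    Cauchy-Schwarz inequality; the same holds for [- g], whence the sign [s]. *)
Lemma C11_quadratic L g x y : C11 L g ->
  `|g y - g x - edot (gradient g x) (y - x)| <= L / 2 * enorm (y - x) ^+ 2.
Proof.
move=> [gd gL]; set v := y - x; set p := gradient g x.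
suff key (s : R) : `|s| = 1 ->
    s * (g y - g x - edot p v) <= L / 2 * enorm v ^+ 2.
  rewrite ler_norml; have := key 1 (normr1 _); have := key (-1) (normrN1 _); lra.
move=> s1.
pose h : R -> R^o := s \*: (fun t : R => g (x + t *: v) : R^o) -
  (s * edot p v) \*: (id : R -> R^o) -
  (L / 2 * enorm v ^+ 2) \*: ((id : R -> R^o) ^+ 2).
have hE (t : R) : h t =
  s * g (x + t *: v) - s * edot p v * t - L / 2 * enorm v ^+ 2 * t ^+ 2 by [].
pose dh (t : R) := s * edot (gradient g (x + t *: v) - p) v - t * (L * enorm v ^+ 2).
have hd (t : R) : is_derive t 1 h (dh t).
  have -> : dh t = s * edot (gradient g (x + t *: v)) v - s * edot p v * 1
      - L / 2 * enorm v ^+ 2 * (2%:R * t ^+ 1 * 1).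
    rewrite /dh edotDl edotNl expr1 !mulr1 mulrBr; congr (_ - _).
    by move: (enorm v ^+ 2) => N; clear; field.
  exact: (is_deriveB (is_deriveB (is_deriveZ s (is_derive_line (gd (x + t *: v))))
    (is_deriveZ (s * edot p v) (is_derive_id t 1)))
    (is_deriveZ (L / 2 * enorm v ^+ 2) (is_deriveX 2 (is_derive_id t 1)))).
have [c c01] : exists2 c, c \in `[0, 1]%R & h 1 - h 0 = dh c * (1 - 0).
  apply: MVT_segment => //.
  by apply: derivable_within_continuous => z _; exact: ex_derive.
have dhc : dh c <= 0.
  move: c01; rewrite in_itv/= => /andP[c0 c1].
  have := edot_le (s *: (gradient g (x + c *: v) - p)) v.
  rewrite edotZl enormZ s1 mul1r => /le_trans h1.
  rewrite /dh subr_le0; apply: h1.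
  have := gL (x + c *: v) x.
  have -> : x + c *: v - x = c *: v by rewrite addrAC subrr add0r.
  rewrite enormZ ger0_norm// => h2.
  have := ler_wpM2r (enorm_ge0 v) h2; lra.
rewrite subr0 mulr1 => E; move: dhc; rewrite -E !hE.
have -> : x + 1 *: v = y by rewrite scale1r /v addrC subrK.
rewrite scale0r addr0; lra.
Qed.

End Smooth.

(** * The approximation theorem *)

Theorem proposition5p1 (R : realType) (n : nat)
    (Lambda Omega : set 'rV[R]_n)
    (Lambda_convex : @convex_set R 'rV[R]_n Lambda)
    (Lambda_compact : compact Lambda)
    (Omega_open : open Omega) (Omega_neq0 : Omega !=set0)
    (Omega_sub : Omega `<=` Lambda)
    (K := Lambda `\` Omega)
    (f : 'rV[R]_n -> R)
    (f_bounded : [bounded f x | x in Lambda])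
    (f_unif : unif_continuous (f : subspace Lambda -> R))
    (A0 : R) (A0_gt0 : 0 < A0) (f_le : forall x, K x -> `|f x| <= A0)
    (ft : 'rV[R]_n -> R)
    (ft_bounded : [bounded ft x | x in [set: 'rV[R]_n]])
    (ft_unif : unif_continuous ft)
    (ft_ext : forall x, Lambda x -> ft x = f x)
    (c0 r : R) (r_gt0 : 0 < r)
    (ft_out : forall x, ~ eball 0 r x -> ft x = c0)
    (K_sub : K `<=` eball 0 r)
    (Rout : R) (r_lt : r < Rout)
    (KR := K `|` ~` eball 0 Rout)
    (fKR := patch (fun=> c0) K f)
    (omega : R -> R)
    (omegaP : is_least_concave_majorant (modulus_of_continuity ft) omega)
    (a b : R) (a_ge0 : 0 <= a) (b_ge0 : 0 <= b)
    (omega_le : forall t, 0 <= t -> omega t <= a * t + b) :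
  [/\
    forall lambda M : R, 0 < lambda -> A0 + lambda * (Rout + r) ^+ 2 < M ->
      forall x, convex_hull K x ->
        `|average_approx KR lambda M fKR x - ft x|
          <= omega (convex_density_radius K x + a / lambda
                    + Num.sqrt (2 * b / lambda)),
    forall L : R, 0 < L -> euclidean_lipschitz L ft ->
      forall lambda M : R, 0 < lambda -> A0 + lambda * (Rout + r) ^+ 2 < M ->
      forall x, convex_hull K x ->
        `|average_approx KR lambda M fKR x - f x|
          <= L * convex_density_radius K x + L ^+ 2 / lambda
  & forall L : R, 0 < L -> C11 L ft ->
      forall lambda M : R, L < lambda -> A0 + lambda * (Rout + r) ^+ 2 < M ->
      (forall x, convex_hull K x ->
        `|average_approx KR lambda M fKR x - ft x|
          <= L / 4 * ((lambda + L / 2) / (lambda - L / 2) + 1)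
             * convex_density_radius K x ^+ 2) /\
      (forall x, K x -> average_approx KR lambda M fKR x = f x)].
Proof.
have [m ft_le] : exists m, forall x, `|ft x| <= m.
  by have [m0 [_ h]] := ft_bounded; exists (m0 + 1) => x; apply: h => //; rewrite ltrDl.
have Kr y : K y -> enorm y < r by move=> /K_sub; rewrite /eball/= subr0.
have out y : r <= enorm y -> ft y = c0.
  by move=> ry; apply: ft_out; rewrite /eball/= subr0; apply/negP; rewrite -leNgt.
have ftK y : K y -> `|ft y| <= A0 by move=> Ky; rewrite ft_ext; [exact: f_le|case: Ky].
have fKRE lambda M : average_approx KR lambda M fKR = average_approx KR lambda M ft.
  apply: eq_average_approx => y [Ky|yout]; rewrite /fKR /patch.
    by rewrite mem_set//; case: Ky => Ly _; rewrite ft_ext.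
  have Ry : Rout <= enorm y.
    by rewrite leNgt; apply/negP => yR; apply: yout; rewrite /eball/= subr0.
  have ry : r <= enorm y by apply: le_trans (ltW r_lt) Ry.
  by rewrite out// memNset// => /Kr; rewrite ltNge ry.
have hull_le x : convex_hull K x -> enorm x <= r.
  move=> /convex_hull_bary [d dK <-]; apply: enorm_bary_le dK => y Ky.
  exact: ltW (Kr y Ky).
have hull_Lambda x : convex_hull K x -> Lambda x.
  by apply: smallest_sub => // y [].
have data x : convex_hull K x -> exists z0 (e : 'rV[R]_n), K z0 /\ enorm e = 1.
  move=> /convex_hull_bary [d /supported_neq0 [z0 Kz0] _].
  have [v Ov] := Omega_neq0; exists z0, ((enorm (z0 - v))^-1 *: (z0 - v)); split => //.
  have z0v : 0 < enorm (z0 - v).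
    apply: enorm_gt0; rewrite subr_eq0; apply/eqP => zv.
    by case: Kz0 => _; rewrite zv.
  by rewrite enormZ gtr0_norm ?invr_gt0// mulVf ?gt_eqF.
have Nft_le y : `|- ft y| <= m by rewrite normrN.
have NftK y : K y -> `|- ft y| <= A0 by rewrite normrN; exact: ftK.
have Nout y : r <= enorm y -> - ft y = - c0 by move=> /out ->.
have [omega_conc omega_ge _] := omegaP.
have maj x y : `|ft x - ft y| <= omega (enorm (x - y)).
  exact: le_trans (le_modulus x y ft_le) (omega_ge _ (enorm_ge0 _)).
(* any concave majorant can be used: the second part needs t |-> L * t *)
have part1 (w : R -> R) (a' b' : R) : concave_on_nonneg w ->
    (forall x y, `|ft x - ft y| <= w (enorm (x - y))) -> 0 <= a' -> 0 <= b' ->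
    (forall t, 0 <= t -> w t <= a' * t + b') ->
    forall lambda M : R, 0 < lambda -> A0 + lambda * (Rout + r) ^+ 2 < M ->
    forall x, convex_hull K x -> `|average_approx KR lambda M fKR x - ft x|
      <= w (convex_density_radius K x + a' / lambda + Num.sqrt (2 * b' / lambda)).
  move=> wc wmaj a'0 b'0 wle lambda M l0 MM x xK; rewrite fKRE.
  have [z0 [e [Kz0 e1]]] := data x xK.
  have Nwmaj u v : `|- ft u - - ft v| <= w (enorm (u - v)).
    by rewrite -opprD normrN.
  have lo := le_average_modulus r_gt0 r_lt e1 Kr Kz0 ftK ft_le out l0 MM
    wc wmaj a'0 b'0 wle xK (hull_le x xK).
  have hi := le_average_modulus r_gt0 r_lt e1 Kr Kz0 NftK Nft_le Nout l0 MM
    wc Nwmaj a'0 b'0 wle xK (hull_le x xK).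
  rewrite average_approxN in hi.
  by rewrite ler_norml lerBlDr lerBrDr; apply/andP; split; lra.
split.
- exact: part1.
- move=> L L0 ftL lambda M l0 MM x xK; rewrite -ft_ext; last exact: hull_Lambda.
  have Lc : concave_on_nonneg (fun t => L * t).
    move=> t u v _ _; rewrite conv_affineE.
    rewrite le_eqVlt; apply/orP; left; apply/eqP.
    change (- (L * (t%:num * u + (1 - t%:num) * v)) =
      t%:num * - (L * u) + (1 - t%:num) * - (L * v)); ring.
  have Lle (t : R) : 0 <= t -> L * t <= L * t + 0 by rewrite addr0.
  have := part1 _ L 0 Lc ftL (ltW L0) (lexx 0) Lle lambda M l0 MM x xK.
  rewrite mulr0 mul0r sqrtr0 addr0 => /le_trans; apply.
  by rewrite mulrDr expr2 mulrA.
- move=> L L0 ftC lambda M Ll MM.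
  have l0 : 0 < lambda by lra.
  have bound x : convex_hull K x -> `|average_approx KR lambda M fKR x - ft x|
      <= L / 2 * convex_density_radius K x ^+ 2.
    move=> xK; rewrite fKRE; have [z0 [e [Kz0 e1]]] := data x xK.
    have quad u : exists p, forall y,
        `|ft y - ft u - edot p (y - u)| <= L / 2 * enorm (y - u) ^+ 2.
      by exists (gradient ft u) => y; exact: C11_quadratic.
    have Nquad u : exists p, forall y,
        `|- ft y - - ft u - edot p (y - u)| <= L / 2 * enorm (y - u) ^+ 2.
      have [p pP] := quad u; exists (- p) => y.
      by rewrite edotNl -!opprD normrN.
    have lo := le_average_C11 r_gt0 r_lt e1 Kr Kz0 ftK ft_le out l0 MM L0 Ll quad xK.
    have hi := le_average_C11 r_gt0 r_lt e1 Kr Kz0 NftK Nft_le Nout l0 MM L0 Ll Nquad xK.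
    rewrite average_approxN in hi.
    by rewrite ler_norml lerBlDr lerBrDr; apply/andP; split; lra.
  split=> [x xK|x Kx].
    apply: le_trans (bound x xK) _; apply: ler_wpM2r; first exact: sqr_ge0.
    have : 1 <= (lambda + L / 2) / (lambda - L / 2).
      by rewrite ler_pdivlMr; lra.
    move: (_ / _) => q q1; rewrite -subr_ge0.
    have -> : L / 4 * (q + 1) - L / 2 = L / 4 * (q - 1) by field.
    by rewrite mulr_ge0 ?subr_ge0// divr_ge0// ltW.
  have xK : convex_hull K x by exact: sub_gen_smallest.
  have := bound x xK; rewrite density_radius_mem// expr0n mulr0 normr_le0 subr_eq0.
  by move=> /eqP ->; rewrite ft_ext//; case: Kx.
Qed.
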